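(* Suppose that $(A,H,D,J)$ is a real spectral triple and $D=\sum_{\ell=1}^N D_\ell$ is such that each $D_\ell$ satisfies the first order condition $[[D_\ell,a],JbJ^{-1}]=0$ for all $a,b\in A$, for every $\ell=1,\dots,N$. Let $k_\ell$, $\ell=1,\dots,N$, be positive elements from $A$ with bounded inverses. Then $(A,H,\tilde D,J)$, where $$\tilde D:=(D_1)_{k_1}+\cdots+(D_N)_{k_N},\qquad (D_\ell)_{k_\ell}=(Jk_\ell J^{-1})\,D_\ell\,(Jk_\ell J^{-1}),$$ satisfies the multitwisted zero order condition and the multitwisted first-order condition with the twists $$\nu_\ell=k_\ell^{-1}\,Jk_\ell J^{-1},$$ is regular, and satisfies the multitwisted $\epsilon'$-condition. Furthermore, if $\tilde D$ has compact resolvent, then $(A,H,\tilde D,J)$ is a spectral triple with a multitwisted real structure.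
   Context: A spectral triple $(A,H,D)$ consists of a $*$-algebra $A$ identified with a subalgebra of $B(H)$, $H$ a Hilbert space, and a densely defined selfadjoint operator $D$ on $H$ with compact resolvent such that $[D,a]$ is bounded for each $a\in A$. A real spectral triple $(A,H,D,J)$ is a spectral triple together with an antilinear isometry $J$ on $H$ with $J^2=\pm1$ and $[a,JbJ^{-1}]=0$ for all $a,b\in A$. It is a real even spectral triple $(A,H,D,J,\gamma)$ if in addition there is a grading $\gamma$ of $H$ with $\gamma^2=1$, $D\gamma=-\gamma D$, $[\gamma,a]=0$ for all $a\in A$ and $\gamma J=\pm J\gamma$. A real spectral triple $(A,H,D,J)$ is a spectral triple with multitwisted real structure if there are $N$ densely defined operators $D_\ell$, $\ell=1,\dots,N$, whose domains contain the domain of $D$, with $\sum_{\ell=1}^N D_\ell=D$, and for every $\ell$ there exists an operator (twist) $\nu_\ell\in B(H)$ with bounded inverse such that for all $a,b\in A$ the multitwisted zero order condition $$[a,J\bar\nu_\ell(b)J^{-1}]=0=[a,J\bar\nu_\ell^{-1}(b)J^{-1}]$$ holds, where $\bar\nu_\ell=\mathrm{Ad}_{\nu_\ell}\in\mathrm{Aut}(B(H))$, i.e. $\bar\nu_\ell(x)=\nu_\ell x\nu_\ell^{-1}$. If the spectral triple is even one additionally assumes $\gamma\nu_\ell^2=\nu_\ell^2\gamma$ for all $\ell$. For a decomposition $D=\sum_\ell D_\ell$ and twists $\nu_\ell$: the multitwisted first-order condition is $[D_\ell,a]\,J\bar\nu_\ell(b)J^{-1}=J\bar\nu_\ell^{-1}(b)J^{-1}\,[D_\ell,a]$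 for all $a,b\in A$ and all $\ell$; the multitwisted $\epsilon'$-condition is $D_\ell J\nu_\ell=\epsilon'\nu_\ell JD_\ell$ for all $\ell$, where $\epsilon'=\pm1$; regularity means $\nu_\ell J\nu_\ell=J$ for each $\ell$. For $(A,H,\tilde D,J)$ these conditions are taken with the decomposition $\tilde D=\sum_\ell (D_\ell)_{k_\ell}$, i.e. with $(D_\ell)_{k_\ell}$ in place of $D_\ell$.
   Formalization: Added: each [D_l,a] is bounded (part of the first order condition); the multitwisted ε'-condition is claimed when D_l J = ε' J D_l for every l; the ''Furthermore'' part assumes each D_l symmetric, as otherwise D̃ need not be selfadjoint. *)

(* Defs.v *)
From mathcomp Require Export all_boot all_order all_algebra sesquilinear.
From mathcomp Require Export complex.
From mathcomp Require Export all_classical all_reals all_analysis.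

Set Implicit Arguments.
Unset Strict Implicit.
Unset Printing Implicit Defensive.

Import Order.TTheory GRing.Theory Num.Theory.
Import numFieldNormedType.Exports.

Local Open Scope classical_set_scope.
Local Open Scope complex_scope.
Local Open Scope ring_scope.

(* The inner product is linear in its first argument and conjugate-linear in
   its second one. *)
Record hilbertType (R : realType) := HilbertType {
  hilbert_sort :> completeNormedModType R[i];
  inner : {dot hilbert_sort for Num.conj};
  inner_norm : forall x : hilbert_sort, `|x| ^+ 2 = inner x x }.

Notation "''[' x , y ]" := (inner _ x y) : ring_scope.

(* A possibly unbounded operator: only the values of [app] on [dom] matter,
   hence the equality [op_eq] below. *)
Record pop (R : realType) (H : hilbertType R) := Pop {
  dom : set H;
  app :> H -> H }.

Section Operators.
Context {R : realType} {H : hilbertType R}.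
Implicit Types (S T : pop H) (a b k f : H -> H).

Definition op_eq S T : Prop :=
  dom S = dom T /\ forall x, dom S x -> S x = T x.

Definition bounded_op a : Prop :=
  linear a /\ exists M : R[i], forall x, `|a x| <= M * `|x|.

(* A two-sided inverse as soon as [f] is bijective, which every use below
   guarantees; [f] need not be linear, so that it applies to the antilinear
   operator [J] as well. *)
Definition inv_op f : H -> H := 'pinv_(fun=> 0) [set: H] f.

Definition bounded_inverse f : Prop := bijective f /\ bounded_op (inv_op f).

Definition Ad f b : H -> H := f \o b \o inv_op f.

Definition positive_op k : Prop := bounded_op k /\ forall x, 0 <= '[k x, x].

Definition compact_op a : Prop :=
  bounded_op a /\ compact (closure [set a x | x in [set x | `|x| <= 1]]).

Definition star_subalgebra (A : set (H -> H)) : Prop :=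
  [/\ forall a, A a -> bounded_op a,
      A 0 /\ (forall (c : R[i]) a b, A a -> A b -> A (c *: a + b)),
      forall a b, A a -> A b -> A (a \o b)
    & forall a, A a ->
        exists2 b, A b & forall x y, '[a x, y] = '[x, b y]].

Definition densely_defined_op T : Prop :=
  [/\ dom T 0,
      forall (c : R[i]) x y, dom T x -> dom T y ->
        dom T (c *: x + y) /\ T (c *: x + y) = c *: T x + T y
    & dense (dom T)].

Definition symmetric_op T : Prop :=
  forall x y, dom T x -> dom T y -> '[T x, y] = '[x, T y].

(* The left-hand side of the equivalence says that [(y, z)] belongs to the
   graph of the adjoint of [T]. *)
Definition selfadjoint_op T : Prop :=
  densely_defined_op T /\
  forall y z, (forall x, dom T x -> '[T x, y] = '[x, z]) <->
              (dom T y /\ T y = z).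

(* [T - z] has a compact everywhere defined inverse for some [z] (hence for
   every [z] in the resolvent set of [T], by the resolvent identity). *)
Definition compact_resolvent T : Prop :=
  exists (z : R[i]) (r : H -> H),
    [/\ compact_op r,
        forall y, dom T (r y) /\ T (r y) - z *: r y = y
      & forall x, dom T x -> r (T x - z *: x) = x].

(* The natural domain of a sum of operators is the intersection of the
   domains of the summands. *)
Definition op_sum N (T : 'I_N -> pop H) : pop H :=
  Pop [set x | forall l, dom (T l) x] (fun x => \sum_(l < N) T l x).

Definition op_compr T b : pop H := Pop [set x | dom T (b x)] (T \o b).

Definition op_compl b T : pop H := Pop (dom T) (b \o T).

(* [T, a] is defined on the domain of [T] and bounded there, and [c] is its
   (unique when [T] is densely defined) bounded extension to [H]. *)
Definition bounded_commutator T a (c : H -> H) : Prop :=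
  bounded_op c /\
  forall x, dom T x -> dom T (a x) /\ T (a x) - a (T x) = c x.

End Operators.

Section SpectralTriples.
Context {R : realType} {H : hilbertType R}.
Implicit Types (A : set (H -> H)) (D T : pop H) (J g k : H -> H).

Definition spectral_triple A D : Prop :=
  [/\ star_subalgebra A,
      selfadjoint_op D,
      compact_resolvent D
    & forall a, A a -> exists c, bounded_commutator D a c].

Definition antilinear_isometry J : Prop :=
  linear_for (Num.conj \; *:%R) J /\ forall x, `|J x| = `|x|.

Definition is_sign (e : R[i]) : Prop := e = 1 \/ e = -1.

Definition real_spectral_triple A D J : Prop :=
  [/\ spectral_triple A D,
      antilinear_isometry J,
      exists2 e, is_sign e & forall x, J (J x) = e *: x
    & forall a b, A a -> A b -> a \o Ad J b = Ad J b \o a].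

Definition real_even_spectral_triple A D J g : Prop :=
  real_spectral_triple A D J /\
  [/\ bounded_op g /\ g \o g = id,
      op_eq (op_compr D g) (op_compl (fun x => - g x) D),
      forall a, A a -> g \o a = a \o g
    & exists2 e, is_sign e & forall x, g (J x) = e *: J (g x)].

(* In the first-order conditions the commutators are required to be bounded,
   and stand for their bounded extensions. *)
Definition first_order A J T : Prop :=
  forall a, A a -> exists2 c, bounded_commutator T a c &
    forall b, A b -> c \o Ad J b = Ad J b \o c.

Definition decomposition N D (D_ : 'I_N -> pop H) : Prop :=
  (forall l, densely_defined_op (D_ l) /\ dom D `<=` dom (D_ l)) /\
  op_eq (op_sum D_) D.

Definition is_twist k : Prop := bounded_op k /\ bounded_inverse k.

Definition multitwisted_zero_order N A J (nu : 'I_N -> H -> H) : Prop :=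
  forall l a b, A a -> A b ->
    a \o Ad J (Ad (nu l) b) = Ad J (Ad (nu l) b) \o a /\
    a \o Ad J (Ad (inv_op (nu l)) b) = Ad J (Ad (inv_op (nu l)) b) \o a.

Definition multitwisted_first_order N A J (D_ : 'I_N -> pop H)
    (nu : 'I_N -> H -> H) : Prop :=
  forall l a, A a -> exists2 c, bounded_commutator (D_ l) a c &
    forall b, A b -> c \o Ad J (Ad (nu l) b) = Ad J (Ad (inv_op (nu l)) b) \o c.

Definition epsilon_condition N J (D_ : 'I_N -> pop H) (e : R[i]) : Prop :=
  forall l, op_eq (op_compr (D_ l) J) (op_compl (fun x => e *: J x) (D_ l)).

Definition multitwisted_epsilon_condition N J (D_ : 'I_N -> pop H)
    (nu : 'I_N -> H -> H) (e : R[i]) : Prop :=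
  forall l, op_eq (op_compr (D_ l) (J \o nu l))
                  (op_compl (fun x => e *: nu l (J x)) (D_ l)).

Definition regular N J (nu : 'I_N -> H -> H) : Prop :=
  forall l, nu l \o J \o nu l = J.

Definition multitwisted_real_structure N A D J (D_ : 'I_N -> pop H)
    (nu : 'I_N -> H -> H) : Prop :=
  [/\ real_spectral_triple A D J,
      decomposition D D_,
      forall l, is_twist (nu l)
    & multitwisted_zero_order A J nu].

Definition even_multitwisted_real_structure N A D J g (D_ : 'I_N -> pop H)
    (nu : 'I_N -> H -> H) : Prop :=
  [/\ real_even_spectral_triple A D J g,
      multitwisted_real_structure A D J D_ nu
    & forall l, g \o (nu l \o nu l) = (nu l \o nu l) \o g].

Definition conformal_rescaling J k T : pop H :=
  op_compl (Ad J k) (op_compr T (Ad J k)).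

End SpectralTriples.

(* Main.v *)
From mathcomp Require Import ring.
Require Import Defs.

(** Write [K := J k J^-1] for an invertible [k] in [A]. By the zero order
    condition [K] and its inverse commute with [A]; moreover [K J = J k], and
    [J K = k J] because [J^2] is a sign. With the twist [nu = k^-1 K] these
    relations give everything algebraic. Conjugating [b] by [nu] only conjugates
    it by [k^-1], so [J nu b nu^-1 J^-1 = K^-1 (J b J^-1) K], a product of
    operators that commute with [A] (lemmas [AdJ_Ad_twist] and
    [twist_zero_order]). The commutator of [K T K] with [a] is [K [T, a] K],
    and its two factors [K] cancel those of the twisted [J b J^-1], leaving
    the ordinary first order condition of [T] ([rescaled_first_order]).
    Regularity and the epsilon condition follow from [nu J nu = J],
    [K J nu = J K] and [nu J K = K J].

    The analytic part is the self-adjointness of the rescaled operator.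
    Positive operators are symmetric and [J] is antiunitary, so [K] is
    symmetric, and so is the sum [Dt] of the operators [K T K]. Its domain
    is an intersection of preimages, whose density is not apparent. Both
    density and self-adjointness are obtained from the compact resolvent
    ([symmetric_compact_resolvent_selfadjoint]): if [r = (Dt - z)^-1] is
    compact, then [(Dt - conj z) r = 1 + (z - conj z) r] is a Cayley
    transform, isometric by symmetry, and an isometry which differs from the
    identity by a compact operator is onto
    ([compact_perturbation_isometry_surj]). With [Dt - z] and [Dt - conj z]
    both onto, a vector orthogonal to the domain vanishes, so the domain is
    dense by the projection theorem ([dense_of_orthogonal_eq0]), and the
    adjoint has the same domain as [Dt]. *)

Set Implicit Arguments.
Unset Strict Implicit.
Unset Printing Implicit Defensive.

Import Order.TTheory GRing.Theory Num.Theory.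
Import numFieldNormedType.Exports.

Local Open Scope classical_set_scope.
Local Open Scope complex_scope.
Local Open Scope ring_scope.

(** * Inner products *)

Section InnerProduct.
Context {R : realType} {H : hilbertType R}.
Implicit Types (x y z : H) (c : R[i]).

Lemma innerC x y : '[x, y] = Num.conj '[y, x].
Proof. by rewrite (hermC (inner H)) expr0 mul1r. Qed.

Lemma innerDl x y z : '[x + y, z] = '[x, z] + '[y, z].
Proof. exact: linearDl. Qed.
Lemma innerDr x y z : '[x, y + z] = '[x, y] + '[x, z].
Proof. exact: linearDr. Qed.
Lemma innerZl c x y : '[c *: x, y] = c * '[x, y].
Proof. exact: linearZl_LR. Qed.
Lemma innerZr c x y : '[x, c *: y] = Num.conj c * '[x, y].
Proof. exact: linearZr_LR. Qed.
Lemma innerNl x y : '[- x, y] = - '[x, y].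
Proof. exact: linearNl. Qed.
Lemma innerNr x y : '[x, - y] = - '[x, y].
Proof. exact: linearNr. Qed.
Lemma inner0r x : '[x, 0] = 0.
Proof. exact: linear0r. Qed.

Definition innerE :=
  (innerDl, innerDr, innerNl, innerNr, innerZl, innerZr).

Lemma inner_inj x y : (forall z, '[z, x] = '[z, y]) -> x = y.
Proof.
move=> xy; apply/eqP; rewrite -subr_eq0 -normr_eq0 -sqrf_eq0 inner_norm.
by rewrite innerDr innerNr xy subrr.
Qed.

(** Polarization: with [c = 1] and [c = 'i], the vanishing of [B] at
    [c *: y + x] gives [B y x + B x y = 0] and [B y x - B x y = 0]. *)
Lemma sesquilinear_eq0 (B : H -> H -> R[i]) :
    (forall c x y z, B (c *: x + y) z = c * B x z + B y z) ->
    (forall c x y z, B z (c *: x + y) = Num.conj c * B z x + B z y) ->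
  (forall x, B x x = 0) -> forall x y, B x y = 0.
Proof.
move=> Bl Br B0 x y.
have Bc c : c * B y x + Num.conj c * B x y = 0.
  by rewrite -(B0 (c *: y + x)) Bl !Br !B0 !(mulr0, add0r, addr0).
have BC : B y x = - B x y.
  by apply/eqP; rewrite -addr_eq0; have := Bc 1; rewrite rmorph1 !mul1r => ->.
have /eqP := Bc 'i; rewrite BC conjCi mulrN mulNr -opprD oppr_eq0 -mulr2n.
by rewrite mulrn_eq0 /= mulf_eq0 (negPf (neq0Ci _)) /= => /eqP.
Qed.

(** The form measuring the failure of symmetry vanishes on the diagonal, where
    the inner product is real. *)
Lemma positive_op_symmetric (k : H -> H) : positive_op k ->
  forall x y, '[k x, y] = '[x, k y].
Proof.
move=> [[klin _] k0] x y; apply/eqP; rewrite -subr_eq0; apply/eqP.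
apply: (@sesquilinear_eq0 (fun x y => '[k x, y] - '[x, k y])) =>
    [c {}x {}y z|c {}x {}y z|{}x].
- rewrite klin !innerE mulrBr; ring.
- rewrite klin !innerE mulrBr; ring.
- by rewrite [X in _ - X]innerC conj_Creal ?subrr// ger0_real.
Qed.

Lemma antilinear_isometry_inner (J : H -> H) : antilinear_isometry J ->
  forall x y, '[J x, J y] = '[y, x].
Proof.
move=> [Jlin Jiso] x y; apply/eqP; rewrite -subr_eq0; apply/eqP.
apply: (@sesquilinear_eq0 (fun y x => '[J x, J y] - '[y, x])) =>
    [c {}x {}y z|c {}x {}y z|{}x].
- rewrite Jlin !innerE conjCK; ring.
- rewrite Jlin !innerE; ring.
- by rewrite -!inner_norm Jiso subrr.
Qed.

Lemma parallelogram x y :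
  `|x + y| ^+ 2 + `|x - y| ^+ 2 = (`|x| ^+ 2 + `|y| ^+ 2) *+ 2.
Proof. rewrite !inner_norm !innerE; ring. Qed.

(** If [x] almost realizes the distance from a point to a subspace, then it is
    almost orthogonal to every vector [y] of this subspace: the best multiple of
    [y] removes [`|'[x, y]| ^+ 2 / `|y| ^+ 2] from the squared norm of [x]. For
    [d = 0] this is the Cauchy-Schwarz inequality. *)
Lemma near_minimizer_inner (d e : R[i]) x y :
    `|x| ^+ 2 <= d + e -> (forall c, d <= `|x - c *: y| ^+ 2) ->
  `|'[x, y]| ^+ 2 <= e * `|y| ^+ 2.
Proof.
have [->|y0] := eqVneq y 0.
  by move=> _ _; rewrite inner0r !normr0 expr0n /= mulr0.
move=> xd /(_ ('[x, y] / `|y| ^+ 2)).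
have y2 : 0 < `|y| ^+ 2 by rewrite exprn_gt0 ?normr_gt0.
rewrite [X in d <= X -> _]inner_norm !innerE (innerC y x) rmorphM fmorphV/=.
rewrite -inner_norm -(inner_norm y) (conj_Creal (ger0_real (ltW y2))).
set u := '[x, y].
have -> : `|x| ^+ 2 - Num.conj u / `|y| ^+ 2 * u +
    (- (u / `|y| ^+ 2 * Num.conj u)
     - u / `|y| ^+ 2 * - (Num.conj u / `|y| ^+ 2 * `|y| ^+ 2)) =
    `|x| ^+ 2 - `|u| ^+ 2 / `|y| ^+ 2.
  by rewrite normCK; field; rewrite normr_eq0.
move=> h; have := le_trans h (lerB xd (lexx _)).
by rewrite -addrA lerDl subr_ge0 ler_pdivrMr.
Qed.

Lemma cauchy_schwarz x y : `|'[x, y]| <= `|x| * `|y|.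
Proof.
rewrite -(@ler_pXn2r _ 2) ?nnegrE ?mulr_ge0// exprMn.
apply: (@near_minimizer_inner 0); first by rewrite add0r.
by move=> c; rewrite exprn_ge0.
Qed.

End InnerProduct.

(** * Completeness and the projection theorem *)

Section Completeness.
Context {R : realType} {H : hilbertType R}.
Implicit Types (x y : H) (M : set H).

Lemma le0_of_small (a b : R[i]) :
  0 <= b -> (forall e, 0 < e -> a <= e * b) -> a <= 0.
Proof.
move=> b0 ab; have ar : a \is Num.real.
  by rewrite (ler_real (ab 1 ltr01)) mul1r ger0_real.
rewrite real_leNgt ?real0//; apply/negP => a0.
have b1 : 0 < b + 1 by rewrite ltr_wpDl.
have := ab (a / (b + 1)); rewrite divr_gt0// => /(_ isT).
by rewrite mulrAC ler_pdivlMr// mulrDr mulr1 gerDl lt_geF.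
Qed.

(** Completeness, in the form used below: nested nonempty sets with diameters
    tending to zero accumulate at one point. It yields both the nearest point of
    a subspace and the closedness of the range of an isometry. *)
Lemma cantor_intersection (S : R[i] -> set H) :
    (forall e, 0 < e -> S e !=set0) ->
    (forall e e', e <= e' -> S e `<=` S e') ->
    (forall e, 0 < e -> exists2 d, 0 < d &
      forall x y, S d x -> S d y -> `|x - y| < e) ->
  exists l, forall e d, 0 < e -> 0 < d -> exists2 x, S d x & `|l - x| < e.
Proof.
move=> S0 Smono Ssmall.
pose F := filter_from [set e : R[i] | 0 < e] S.
have PF : ProperFilter F.
  apply: filter_from_proper => [|e /S0//].
  apply: filter_from_filter; first by exists 1; rewrite /= ltr01.
  move=> e e' /= e0 e'0; have ee' : e >=< e'.
    by apply: real_comparable; exact: gtr0_real.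
  case: (comparable_leP ee') => h; [exists e|exists e'] => // x Sx;
    split=> //.
    exact: Smono Sx.
  exact: Smono (ltW h) _ Sx.
have /cauchy_cvg /cvg_ex[l Fl] : cauchy F.
  apply/cauchy_exP => e /Ssmall[d d0 Sd]; have [x Sx] := S0 _ d0.
  exists x, d => // y Sy; rewrite -ball_normE /=; exact: Sd.
exists l => e d e0 d0.
have [d' /= d'0 Sd'] : F (ball l e) by apply: Fl; exact: nbhsx_ballx.
have Fe : F (ball l e) by exists d'.
have Fd : F (S d) by exists d.
have [x [lx Sx]] := filter_ex (filterI Fe Fd).
by exists x => //; move: lx; rewrite -ball_normE.
Qed.

Lemma square_distance_inf M y : M !=set0 -> exists d : R[i],
  (forall m, M m -> d <= `|y - m| ^+ 2) /\
  (forall e, 0 < e -> exists2 m, M m & `|y - m| ^+ 2 < d + e).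
Proof.
case=> m0 Mm0; pose f m := complex.Re (`|y - m| ^+ 2).
have fE m : (f m)%:C = `|y - m| ^+ 2.
  exact/RRe_real/ger0_real/exprn_ge0.
have Einf : has_inf [set f m | m in M].
  split; first by exists (f m0), m0.
  exists 0 => _ [m _ <-]; rewrite -lecR fE; exact: exprn_ge0.
exists (inf [set f m | m in M])%:C; split=> [m Mm|e e0].
  by rewrite -fE lecR; apply: ge_inf; [case: Einf|exists m].
have eE : (complex.Re e)%:C = e.
  exact/RRe_real/gtr0_real.
have [|_ [m Mm <-] h] := @inf_adherent _ _ (complex.Re e) _ Einf.
  by rewrite -ltcR eE.
by exists m => //; rewrite -fE -eE -rmorphD ltcR.
Qed.

(** The projection theorem: by the parallelogram identity the near minimizers
    of the distance from [y] to [M] form sets of small diameter, hence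
    accumulate at a point [l] of the closure of [M]; as [y - l] is orthogonal to
    [M], it is zero. *)
Lemma dense_of_orthogonal_eq0 M :
    M 0 -> (forall c x y, M x -> M y -> M (c *: x + y)) ->
    (forall y, (forall x, M x -> '[y, x] = 0) -> y = 0) ->
  dense M.
Proof.
move=> M0 Mlin Mperp.
suff MH y e : 0 < e -> exists2 m, M m & `|y - m| < e.
  move=> O [y Oy] Oo; have /nbhs_ballP[e /= e0 eO] : nbhs y O.
    exact: open_nbhs_nbhs.
  have [m Mm ym] := MH y e e0; exists m; split=> //; apply: eO.
  by rewrite -ball_normE.
have [d [dM dinf]] := @square_distance_inf M y (ex_intro _ 0 M0).
pose S (r : R[i]) := [set m | M m /\ `|y - m| ^+ 2 < d + r].
have dMc m c m' : M m -> M m' -> d <= `|y - m - c *: m'| ^+ 2.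
  by move=> Mm Mm'; rewrite -addrA -opprD (addrC m); apply/dM/Mlin.
have [|r r' rr' m [Mm lt]|r r0|l lS] := cantor_intersection (S := S).
- by move=> r /dinf[m Mm lt]; exists m.
- by split=> //; apply: lt_le_trans lt _; rewrite lerD2l.
- exists (r ^+ 2 / 4) => [|m m' [Mm lt] [Mm' lt']].
    by rewrite divr_gt0// exprn_gt0.
  rewrite -(@ltr_pXn2r _ 2) ?nnegrE// ?ltW//.
  (* The midpoint of [m] and [m'] lies in [M], which bounds the first term of
     the parallelogram identity for [y - m] and [y - m'] below by [4 * d]. *)
  pose c := 2%:R^-1 : R[i].
  have c2 : c + c = 1 by rewrite /c; field.
  have Mc : M (c *: m + (c *: m' + 0)) by do 2 apply: (Mlin) => //.
  have := parallelogram (y - m) (y - m').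
  rewrite addrC opprD opprK addrACA subrr add0r.
  have -> : y - m + (y - m') = 2 *: (y - (c *: m + (c *: m' + 0))).
    rewrite addr0 -scalerDr scalerBr scalerA mulr_natl (mulr2n c) c2 scale1r.
    by rewrite scaler_nat mulr2n opprD addrACA.
  rewrite normrZ exprMn normr_nat (addrC (- m)) => E.
  rewrite (distrC m m').
  have {E} -> := canRL (addrK _) E; have := dM _ Mc.
  set a := `|_| ^+ 2 in lt *; set b := `|_| ^+ 2 in lt' *.
  set q := `|_| ^+ 2 => dq.
  have lt1 : (a + b) *+ 2 < (d + r ^+ 2 / 4 + (d + r ^+ 2 / 4)) *+ 2.
    by rewrite ltrMn2r /= ltrD.
  have dq' : 4 * d <= 2%:R ^+ 2 * q by rewrite -natrX ler_wpM2l.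
  apply: lt_le_trans (ltr_leB lt1 dq') _.
  by rewrite le_eqVlt; apply/orP; left; apply/eqP; field.
rewrite -(_ : l = y).
  by move=> e0; have [m [Mm _] lm] := lS _ 1 e0 ltr01; exists m.
apply/esym/eqP; rewrite -subr_eq0; apply/eqP/Mperp => m' Mm'.
apply/eqP; rewrite -normr_le0; apply: (@le0_of_small _ (`|m'| *+ 2)).
  by rewrite mulrn_wge0.
move=> {}e e0; have e20 : 0 < e ^+ 2 by rewrite exprn_gt0.
have [m [Mm lt] lm] := lS _ _ e0 e20.
rewrite -(subrK m y) -addrA innerDl mulrnAr mulr2n.
apply: le_trans (ler_normD _ _) (lerD _ _).
  rewrite -(@ler_pXn2r _ 2) ?nnegrE ?mulr_ge0 ?(ltW e0)// exprMn.
  by apply: near_minimizer_inner (ltW lt) _ => c; exact: dMc.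
apply: le_trans (cauchy_schwarz _ _) _; rewrite ler_wpM2r// distrC ltW//.
Qed.

End Completeness.

(** * Symmetric operators with compact resolvent *)

Section SelfAdjoint.
Context {R : realType} {H : hilbertType R}.
Implicit Types (x y : H) (U r : H -> H) (T : pop H).

Lemma linear_funB U : linear U -> {morph U : x y / x - y}.
Proof. by move=> Ulin x y; rewrite addrC -scaleN1r Ulin scaleN1r addrC. Qed.

Lemma linear_fun0 U : linear U -> U 0 = 0.
Proof. by move=> Ulin; have := linear_funB Ulin 0 0; rewrite !subrr. Qed.

Lemma linear_funZ U : linear U -> forall (c : R[i]) x, U (c *: x) = c *: U x.
Proof.
by move=> Ulin c x; rewrite -[c *: x]addr0 Ulin linear_fun0// addr0.
Qed.

Definition linear_op T : Prop := dom T 0 /\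
  forall (c : R[i]) x y, dom T x -> dom T y ->
    dom T (c *: x + y) /\ T (c *: x + y) = c *: T x + T y.

Lemma isometry_range_closed U : linear U -> (forall x, `|U x| = `|x|) ->
  forall y, (forall e, 0 < e -> exists x, `|y - U x| < e) ->
  exists x, U x = y.
Proof.
move=> Ulin Uiso y Uy; pose S (e : R[i]) := [set x | `|y - U x| < e].
have [|e e' ee' x|e e0|x xS] := cantor_intersection (S := S).
- exact: Uy.
- by move=> /= xe; exact: lt_le_trans ee'.
- have e20 : 0 < e / 2 by rewrite divr_gt0.
  exists (e / 2) => // x x' /= Sx Sx'; rewrite -Uiso (linear_funB Ulin).
  have -> : U x - U x' = (y - U x') - (y - U x).
    by rewrite opprB [RHS]addrC addrA subrK.
  by apply: le_lt_trans (ler_normB _ _) _; rewrite [ltRHS]splitr ltrD.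
exists x; apply/eqP; rewrite -subr_eq0 -normr_le0.
apply: (@le0_of_small _ _ 2) => // e e0; have [x' yx' xx'] := xS _ _ e0 e0.
have -> : U x - y = (U x - U x') - (y - U x') by rewrite opprB addrA subrK.
rewrite mulr_natr mulr2n; apply: le_trans (ler_normB _ _) (lerD _ (ltW yx')).
by rewrite -(linear_funB Ulin) Uiso ltW.
Qed.

(** Let [U x := x + c *: r x] be such an isometry. It commutes with [r], so the
    points [r (U^n x) = U^n (r x)], [`|x| <= 1], lie in a relatively compact set
    and come arbitrarily close to each other. Since [U] is isometric, the
    distance between the terms of index [n < m] is that from [r x] to
    [U^(m - n) (r x)]. Thus [r x] belongs to the closure of the range of [U],
    which is closed; so does [y = U y - c *: r y] for every [y]. *)
Lemma compact_perturbation_isometry_surj (c : R[i]) r : compact_op r ->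
    (forall x, `|x + c *: r x| = `|x|) ->
  forall y, exists x, x + c *: r x = y.
Proof.
move=> [[rlin _] rK]; pose U x := x + c *: r x => Uiso'.
have {Uiso'} Uiso x : `|U x| = `|x| by exact: Uiso'.
have Ulin : linear U.
  move=> a x y; rewrite /U rlin !scalerDr !scalerA [c * a]mulrC addrACA.
  by rewrite -!scalerA.
have rU x : r (U x) = U (r x) by rewrite /U addrC rlin addrC.
have ballU x : `|x| <= 1 -> exists v, U v = r x.
  move=> x1; apply: (isometry_range_closed Ulin) => // e e0.
  pose p n := r (iter n U x).
  have pE n : p n = iter n U (r x).
    by rewrite /p; elim: n => //= n IH; rewrite rU IH.
  have itU n y z : `|iter n U y - iter n U z| = `|y - z|.
    by elim: n => //= n <-; rewrite -(linear_funB Ulin) Uiso.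
  have pK n : closure [set r z | z in [set z | `|z| <= 1]] (p n).
    apply: subset_closure; exists (iter n U x) => //=.
    by elim: n => //= n; rewrite Uiso.
  have [q [_ Fq]] : closure [set r z | z in [set z | `|z| <= 1]] `&`
      cluster (p @ \oo) !=set0.
    by apply: rK; exists 0%N => // n _; exact: pK.
  have e20 : 0 < e / 2 by rewrite divr_gt0.
  have near n : exists2 m, (n < m)%N & `|q - p m| < e / 2.
    have [||_ [[m nm <-]]] := Fq [set p m | m in [set m | (n < m)%N]]
        (ball q (e / 2)).
    - by exists n.+1 => // m nm; exists m.
    - exact: nbhsx_ballx.
    by rewrite -ball_normE; exists m.
  have [n _ qn] := near 0%N; have [m nm qm] := near n.
  exists (iter (m - n).-1 U (r x)); rewrite -iterS prednK ?subn_gt0//.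
  rewrite -(itU n) -iterD subnKC ?(ltnW nm)// -!pE.
  have -> : p n - p m = (q - p m) - (q - p n).
    by rewrite opprB [RHS]addrC addrA subrK.
  by apply: le_lt_trans (ler_normB _ _) _; rewrite [ltRHS]splitr ltrD.
have rangeU x : exists v, U v = r x.
  have [->|x0] := eqVneq x 0.
    by exists 0; rewrite !linear_fun0.
  have nx0 : `|x| != 0 by rewrite normr_eq0.
  have [|v Uv] := ballU (`|x|^-1 *: x).
    by rewrite normrZ normfV normr_id mulVf.
  exists (`|x| *: v); rewrite (linear_funZ Ulin) Uv (linear_funZ rlin).
  by rewrite scalerA mulfV// scale1r.
move=> y; have [v Uv] := rangeU y; exists (y - c *: v).
by rewrite -/(U _) addrC -scaleNr Ulin Uv scaleNr addrC /U addrK.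
Qed.

(** The isometry of the Cayley transform. *)
Lemma symmetric_norm_shift T (z : R[i]) x : symmetric_op T -> dom T x ->
  `|T x - Num.conj z *: x| = `|T x - z *: x|.
Proof.
move=> Tsym Tx; apply/eqP; rewrite -(@eqrXn2 _ 2)//; apply/eqP.
rewrite !inner_norm !innerE (Tsym _ _ Tx Tx) conjCK; ring.
Qed.

(** Let [r := (T - z)^-1] be compact. Then [1 + (z - conj z) r = (T - conj z) r]
    is isometric, because [T] is symmetric, hence onto: both [T - z] and
    [T - conj z] are onto. Testing against these two full ranges shows that a
    vector orthogonal to the domain is zero, so that the domain is dense, and
    that a vector of the domain of the adjoint lies in the domain of [T]. *)
Lemma symmetric_compact_resolvent_selfadjoint T :
  linear_op T -> symmetric_op T -> compact_resolvent T -> selfadjoint_op T.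
Proof.
move=> [T0 Tlin] Tsym [z [r [rcomp rr rl]]].
have surj y : exists2 x, dom T x & T x - Num.conj z *: x = y.
  have Ur x : x + (z - Num.conj z) *: r x = T (r x) - Num.conj z *: r x.
    by have [_ {1}<-] := rr x; rewrite scalerBl addrA subrK.
  have [x|x Ux] :=
      compact_perturbation_isometry_surj (c := z - Num.conj z) rcomp _ y.
    have [dx Trx] := rr x.
    by rewrite Ur symmetric_norm_shift// Trx.
  by exists (r x); [case: (rr x)|rewrite -Ur].
split; last first.
  move=> y w; split=> [adj|[Ty <-] x Tx]; last exact: Tsym.
  have [u Tu uE] := surj (w - Num.conj z *: y).
  suff yu : y = u.
    split; rewrite yu//; move: uE; rewrite yu => /addIr; exact.
  apply: inner_inj => v; have [dv <-] := rr v.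
  have := congr1 (fun t => '[r v, t]) uE.
  by rewrite /= !innerE conjCK -(adj _ dv) -(Tsym _ _ dv Tu) => ->.
split=> //; apply: dense_of_orthogonal_eq0 => // [c x y dx dy|y yT].
  by case: (Tlin c _ _ dx dy).
have [_ <-] := rr y; have [dy _] := rr y.
suff -> : r y = 0.
  have [_] := Tlin (-1) _ _ T0 T0.
  by rewrite !scaler0 !add0r scaleN1r addNr subr0.
apply: inner_inj => v; have [u Tu <-] := surj v.
have -> : '[T u - Num.conj z *: u, r y] = '[u, T (r y) - z *: r y].
  by rewrite !innerE (Tsym _ _ Tu dy).
by have [_ ->] := rr y; rewrite innerC yT// rmorph0 inner0r.
Qed.

End SelfAdjoint.

(** * Bounded operators and inverses *)

Lemma cancel_inv_op (R : realType) (H : hilbertType R) (f g : H -> H) :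
  cancel f g -> cancel g f -> inv_op f = g.
Proof.
move=> fK gK; apply/funext => y; apply: (can_inj fK); rewrite gK.
by rewrite /inv_op pinvK// inE; exists (g y).
Qed.

Section Inverse.
Context {R : realType} {H : hilbertType R}.
Implicit Types f : H -> H.

Lemma inv_opK f : bijective f -> cancel f (inv_op f).
Proof. by case=> g fK gK; rewrite (cancel_inv_op fK gK). Qed.

Lemma inv_opKV f : bijective f -> cancel (inv_op f) f.
Proof. by case=> g fK gK; rewrite (cancel_inv_op fK gK). Qed.

End Inverse.

Section BoundedOperators.
Context {R : realType} {H : hilbertType R}.
Implicit Types (x y : H) (a b f g k : H -> H).

Lemma bounded_op_comp a b : bounded_op a -> bounded_op b -> bounded_op (a \o b).
Proof.
move=> [alin [M aM]] [blin [M' bM']]; split=> [c x y /=|].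
  by rewrite blin alin.
exists (`|M| * `|M'|) => x /=.
(* A bound [L] need not be nonnegative, not even real, when [H] is trivial. *)
have norm_bound (L t u : R[i]) :
    0 <= t -> 0 <= u -> u <= L * t -> u <= `|L| * t.
  move=> t0 u0 le; have Lt : 0 <= L * t by exact: le_trans le.
  by rewrite -[X in _ * X](ger0_norm t0) -normrM (ger0_norm Lt).
apply: le_trans (norm_bound _ _ _ _ _ (aM _)) _ => //.
by rewrite -mulrA ler_wpM2l//; exact: norm_bound.
Qed.

Lemma bounded_op_sum N (a : 'I_N -> H -> H) : (forall i, bounded_op (a i)) ->
  bounded_op (fun x => \sum_i a i x).
Proof.
move=> ab; split=> [c x y|].
  rewrite scaler_sumr -big_split /=; apply: eq_bigr => i _.
  by case: (ab i) => ->.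
have [M aM] := choice (fun i => proj2 (ab i)).
exists (\sum_i M i) => x; rewrite mulr_suml.
by apply: le_trans (ler_norm_sum _ _ _) (ler_sum _ _) => i _; exact: aM.
Qed.

Lemma commute_inv_op f g : bijective f -> g \o f = f \o g ->
  g \o inv_op f = inv_op f \o g.
Proof.
move=> fbij gf; apply/funext => x; apply: (bij_inj fbij).
have /= := congr1 (@^~ (inv_op f x)) gf.
by rewrite !inv_opKV// => ->; rewrite inv_opKV.
Qed.

Lemma comp_bijective_inv_op f g : bijective f -> bijective g ->
  bijective (f \o g) /\ inv_op (f \o g) = inv_op g \o inv_op f.
Proof.
move=> fb gb; have c1 : cancel (f \o g) (inv_op g \o inv_op f).
  by move=> x /=; rewrite !inv_opK.
have c2 : cancel (inv_op g \o inv_op f) (f \o g).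
  by move=> x /=; rewrite !inv_opKV.
by split; [exists (inv_op g \o inv_op f)|exact: cancel_inv_op].
Qed.

End BoundedOperators.

(** * Conjugation by the real structure *)

Section Conjugation.
Context {R : realType} {H : hilbertType R} (J : H -> H) (e : R[i]).
Context (Jai : antilinear_isometry J) (e_sign : is_sign e).
Context (JJ : forall x, J (J x) = e *: x).
Implicit Types (x y : H) (a b f k : H -> H).

Lemma sign_conj (s : R[i]) : is_sign s -> Num.conj s = s /\ s * s = 1.
Proof. by case=> ->; rewrite ?rmorphN rmorph1 ?mulrNN mulr1. Qed.

Lemma antilinearZ c x : J (c *: x) = Num.conj c *: J x.
Proof.
have J0 : J 0 = 0 by apply/eqP; rewrite -normr_eq0 (proj2 Jai) normr0.
by case: Jai => /(_ c x 0) + _; rewrite /= J0 !addr0.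
Qed.

Lemma real_structure_bij : bijective J /\ inv_op J = (fun x => e *: J x).
Proof.
have [ce ee] := sign_conj e_sign.
have c1 : cancel J (fun x => e *: J x).
  by move=> x; rewrite JJ scalerA ee scale1r.
have c2 : cancel (fun x => e *: J x) J.
  by move=> x; rewrite antilinearZ ce JJ scalerA ee scale1r.
by split; [exists (fun x => e *: J x)|exact: cancel_inv_op].
Qed.

Let JI := inv_opKV (proj1 real_structure_bij).
Let IJ := inv_opK (proj1 real_structure_bij).

Lemma Ad_comp a b : Ad J (a \o b) = Ad J a \o Ad J b.
Proof. by apply/funext => x; rewrite /Ad /= IJ. Qed.

Lemma Ad_bij a : bijective a ->
  bijective (Ad J a) /\ inv_op (Ad J a) = Ad J (inv_op a).
Proof.
move=> ab; have c1 : cancel (Ad J a) (Ad J (inv_op a)).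
  by move=> x; rewrite /Ad /= IJ inv_opK// JI.
have c2 : cancel (Ad J (inv_op a)) (Ad J a).
  by move=> x; rewrite /Ad /= IJ inv_opKV// JI.
by split; [exists (Ad J (inv_op a))|exact: cancel_inv_op].
Qed.

Lemma bounded_op_Ad a : bounded_op a -> bounded_op (Ad J a).
Proof.
move=> [alin [M aM]]; have [Jlin Jiso] := Jai; split=> [c x y|].
  rewrite /Ad /= (proj2 real_structure_bij) Jlin scalerDr scalerA mulrC.
  rewrite -scalerA /=.
  by rewrite alin Jlin /= conjCK.
exists M => x; rewrite /Ad /= Jiso; apply: le_trans (aM _) _.
by rewrite -(Jiso (inv_op J x)) JI.
Qed.

Lemma AdJ a x : Ad J a (J x) = J (a x).
Proof. by rewrite /Ad /= IJ. Qed.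

Lemma JAd a x : linear a -> J (Ad J a x) = a (J x).
Proof.
move=> alin; have [ce ee] := sign_conj e_sign.
rewrite /Ad /= JJ (proj2 real_structure_bij).
by rewrite (linear_funZ alin) scalerA ee scale1r.
Qed.

Lemma Ad_symmetric k : (forall x y, '[k x, y] = '[x, k y]) ->
  forall x y, '[Ad J k x, y] = '[x, Ad J k y].
Proof.
move=> ks x y; rewrite -{1}[y]JI -{2}[x]JI /Ad /=.
by rewrite !(antilinear_isometry_inner Jai) ks.
Qed.

(** The two signs produced by moving [g] across [J] and across its inverse
    cancel. *)
Lemma commute_Ad g a (s : R[i]) : is_sign s -> linear g ->
    (forall x, g (J x) = s *: J (g x)) -> g \o a = a \o g -> linear a ->
  g \o Ad J a = Ad J a \o g.
Proof.
move=> /sign_conj[cs ss] glin gJ ga alin; apply/funext => x.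
rewrite /Ad /= (proj2 real_structure_bij) gJ.
have /= -> := congr1 (@^~ (e *: J x)) ga.
rewrite (linear_funZ glin) gJ scalerA mulrC -scalerA (linear_funZ alin).
by rewrite antilinearZ cs scalerA ss scale1r.
Qed.

End Conjugation.

(** * Conformal rescaling of one operator *)

Section ConformalRescaling.
Context {R : realType} {H : hilbertType R} (A : set (H -> H)) (J : H -> H).
Context (e : R[i]) (Jai : antilinear_isometry J) (e_sign : is_sign e).
Context (JJ : forall x, J (J x) = e *: x).
Context (zero_order :
  forall a b, A a -> A b -> a \o Ad J b = Ad J b \o a).
Context (k : H -> H) (Ak : A k) (kb : bounded_op k) (ki : bounded_inverse k).
Implicit Types (x y : H) (a b : H -> H) (T : pop H).

Let K := Ad J k.
Let nu := inv_op k \o K.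

Let klin : linear k. Proof. by case: kb. Qed.
Let kbij : bijective k. Proof. by case: ki. Qed.
Let Kb : bounded_op K. Proof. exact: (bounded_op_Ad Jai e_sign JJ). Qed.
Let Klin : linear K. Proof. by case: Kb. Qed.
Let Kbij : bijective K. Proof. exact: proj1 (Ad_bij Jai e_sign JJ kbij). Qed.
Let invK : inv_op K = Ad J (inv_op k).
Proof. exact: proj2 (Ad_bij Jai e_sign JJ kbij). Qed.

Let KJ x : K (J x) = J (k x). Proof. exact: (AdJ Jai e_sign JJ). Qed.
Let JK x : J (K x) = k (J x). Proof. exact: (JAd Jai e_sign JJ). Qed.

Lemma commute_AdJ a x : A a -> a (K x) = K (a x).
Proof. by move=> Aa; have /= := congr1 (@^~ x) (zero_order Aa Ak). Qed.

Lemma commute_inv_AdJ a x : A a -> a (inv_op K x) = inv_op K (a x).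
Proof.
move=> Aa; have := commute_inv_op Kbij (zero_order Aa Ak).
by move=> /(congr1 (@^~ x)).
Qed.

Lemma twist_bij : bijective nu /\ inv_op nu = inv_op K \o k.
Proof.
have kVbij : bijective (inv_op k).
  by exists k; [exact: inv_opKV|exact: inv_opK].
have [nub ->] := comp_bijective_inv_op kVbij Kbij; split=> //.
by congr (_ \o _); apply: cancel_inv_op; [exact: inv_opKV|exact: inv_opK].
Qed.

Lemma twist_is_twist : is_twist nu.
Proof.
have [_ kVb] := ki; have [nubij nuV] := twist_bij.
split; first exact: bounded_op_comp.
split=> //; rewrite nuV invK; apply: bounded_op_comp => //.
exact: (bounded_op_Ad Jai e_sign JJ).
Qed.

(** [Ad J k] commutes with [b] by the zero order condition, so only the factor
    [inv_op k] of the twist acts on [b]. *)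
Lemma Ad_twist b : A b -> Ad nu b = inv_op k \o b \o k.
Proof.
move=> Ab; apply/funext => x; rewrite /Ad (proj2 twist_bij) /nu /=.
by rewrite commute_inv_AdJ// inv_opKV.
Qed.

Lemma Ad_inv_twist b : A b -> Ad (inv_op nu) b = k \o b \o inv_op k.
Proof.
move=> Ab; apply/funext => x.
rewrite /Ad (@cancel_inv_op _ _ (inv_op nu) nu); last 2 first.
- exact: (inv_opKV (proj1 twist_bij)).
- exact: (inv_opK (proj1 twist_bij)).
rewrite (proj2 twist_bij) /nu /= -(commute_inv_AdJ _ Ak); congr (k _).
have kVK : inv_op k (K x) = K (inv_op k x).
  have := commute_inv_op kbij (esym (zero_order Ak Ak)).
  by move=> /(congr1 (@^~ x)) /= <-.
by rewrite kVK commute_AdJ// inv_opK.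
Qed.

(** Conjugating by [J] turns [k] into [K], so that the twisted [Ad J b] involves
    only operators which commute with [A]. *)
Lemma AdJ_Ad_twist b : A b -> Ad J (Ad nu b) = inv_op K \o Ad J b \o K.
Proof. by move=> Ab; rewrite Ad_twist// 2!(Ad_comp Jai e_sign JJ) invK. Qed.

Lemma AdJ_Ad_inv_twist b : A b ->
  Ad J (Ad (inv_op nu) b) = K \o Ad J b \o inv_op K.
Proof. by move=> Ab; rewrite Ad_inv_twist// 2!(Ad_comp Jai e_sign JJ) invK. Qed.

Lemma twist_zero_order a b : A a -> A b ->
  a \o Ad J (Ad nu b) = Ad J (Ad nu b) \o a /\
  a \o Ad J (Ad (inv_op nu) b) = Ad J (Ad (inv_op nu) b) \o a.
Proof.
move=> Aa Ab; rewrite AdJ_Ad_twist// AdJ_Ad_inv_twist//.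
have ab x : a (Ad J b x) = Ad J b (a x).
  by have /= := congr1 (@^~ x) (zero_order Aa Ab).
split; apply/funext => x /=.
  by rewrite commute_inv_AdJ// ab commute_AdJ.
by rewrite commute_AdJ// ab commute_inv_AdJ.
Qed.

Lemma rescaled_commutator T a c : A a -> bounded_commutator T a c ->
  bounded_commutator (conformal_rescaling J k T) a (K \o c \o K).
Proof.
move=> Aa [cb Tc]; split; first by do 2 apply: bounded_op_comp => //.
move=> x /= /Tc[dx cx]; rewrite -/K -commute_AdJ//; split=> //.
by rewrite (commute_AdJ (T (K x)))// -(linear_funB Klin) cx.
Qed.

(** The bounded extension of the commutator is [K c K], where [c] is that of
    [T]. The outer factors absorb the twists, as [K c K (K^-1 b' K) = K c b' K]
    and [(K b' K^-1) K c K = K b' c K] with [b' := Ad J b]; what remains is that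
    [c] commutes with [b']. *)
Lemma rescaled_first_order T a : first_order A J T -> A a ->
  exists2 c, bounded_commutator (conformal_rescaling J k T) a c &
    forall b, A b -> c \o Ad J (Ad nu b) = Ad J (Ad (inv_op nu) b) \o c.
Proof.
move=> T1 Aa; have [c Tc cJ] := T1 _ Aa; exists (K \o c \o K).
  exact: rescaled_commutator.
move=> b Ab; rewrite AdJ_Ad_twist// AdJ_Ad_inv_twist//; apply/funext => x /=.
rewrite inv_opKV// inv_opK//; congr K.
by have /= := congr1 (@^~ (K x)) (cJ _ Ab).
Qed.

Lemma twist_regular : nu \o J \o nu = J.
Proof.
apply/funext => x; rewrite /nu /= KJ inv_opKV//.
by rewrite JK inv_opK.
Qed.

(** Since [K J = J k] and [J K = k J], the twist gives [K J nu = J K] and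
    [nu J K = K J], which reduces the claim to the condition on [T] at [K x]. *)
Lemma rescaled_epsilon T (s : R[i]) :
    op_eq (op_compr T J) (op_compl (fun x => s *: J x) T) ->
  op_eq (op_compr (conformal_rescaling J k T) (J \o nu))
        (op_compl (fun x => s *: nu (J x)) (conformal_rescaling J k T)).
Proof.
move=> [/= domJ TJ].
have domTJ x : dom T (J x) = dom T x by exact: (congr1 (@^~ x) domJ).
have KJnu x : K (J (nu x)) = J (K x).
  by rewrite /nu /= KJ inv_opKV.
split=> /= [|x]; first by apply/funext => x; rewrite /= -/K KJnu domTJ.
rewrite -/K KJnu domTJ => dx.
rewrite (TJ (K x)) ?(domTJ (K x))// (linear_funZ Klin) /nu /=.
by rewrite JK -(commute_AdJ _ Ak) inv_opK.
Qed.

Lemma rescaled_symmetric T : positive_op k -> symmetric_op T ->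
  symmetric_op (conformal_rescaling J k T).
Proof.
move=> kpos Tsym x y /= dx dy; have ks := positive_op_symmetric kpos.
have KS := Ad_symmetric Jai e_sign JJ ks.
by rewrite -/K KS -/K Tsym// KS.
Qed.

Lemma rescaled_linear T : linear_op T ->
  linear_op (conformal_rescaling J k T).
Proof.
move=> [T0 Tlin]; split; first by rewrite /= -/K linear_fun0.
move=> c x y /= dx dy; rewrite -/K Klin.
by have [? ->] := Tlin c _ _ dx dy; rewrite Klin.
Qed.

Lemma twist_grading g (s : R[i]) : is_sign s -> bounded_op g ->
    g \o k = k \o g -> (forall x, g (J x) = s *: J (g x)) ->
  g \o nu = nu \o g.
Proof.
move=> ss [glin _] gk gJ; apply/funext => x.
have := congr1 (@^~ (K x)) (commute_inv_op kbij gk); rewrite /nu /= => ->.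
congr inv_op.
have := commute_Ad Jai e_sign JJ ss glin gJ gk klin.
by move=> /(congr1 (@^~ x)).
Qed.

End ConformalRescaling.

(** * Sums of unbounded operators *)

Section OperatorSums.
Context {R : realType} {H : hilbertType R} (N : nat) (T : 'I_N -> pop H).
Implicit Types x y : H.

Lemma op_sum_linear : (forall i, linear_op (T i)) -> linear_op (op_sum T).
Proof.
move=> Tlin; split=> [i|c x y dx dy]; first by case: (Tlin i).
have Tl i := proj2 (Tlin i) c x y (dx i) (dy i).
split=> [i|/=]; first by case: (Tl i).
rewrite scaler_sumr -big_split; apply: eq_bigr => i _ /=.
by case: (Tl i).
Qed.

Lemma op_sum_symmetric : (forall i, symmetric_op (T i)) ->
  symmetric_op (op_sum T).
Proof.
move=> Tsym x y dx dy /=.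
rewrite linear_sumr linear_sumlz.
by apply: eq_bigr => i _; exact: Tsym.
Qed.

Lemma op_sum_commutator a (c : 'I_N -> H -> H) : linear a ->
    (forall i, bounded_commutator (T i) a (c i)) ->
  bounded_commutator (op_sum T) a (fun x => \sum_i c i x).
Proof.
move=> alin Tc; split=> [|x dx].
  by apply: bounded_op_sum => i; case: (Tc i).
have Tcx i := proj2 (Tc i) x (dx i).
split=> [i|/=]; first by case: (Tcx i).
have -> : a (\sum_i T i x) = \sum_i a (T i x).
  apply: (big_morph a); last exact: linear_fun0.
  by move=> y z; rewrite -[y]scale1r alin !scale1r.
by rewrite -sumrB; apply: eq_bigr => i _; case: (Tcx i).
Qed.

End OperatorSums.

(** * Multitwisted real structures from conformal rescalings *)

Theorem proposition2p10 (R : realType) (H : hilbertType R)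
    (A : set (H -> H)) (D : pop H) (J : H -> H)
    (N : nat) (D_ : 'I_N -> pop H) (k : 'I_N -> H -> H)
    (hD : real_spectral_triple A D J)
    (hdec : decomposition D D_)
    (hfirst : forall l, first_order A J (D_ l))
    (hk : forall l, [/\ A (k l), positive_op (k l) & bounded_inverse (k l)]) :
  let Dt_ := fun l => conformal_rescaling J (k l) (D_ l) in
  let Dt := op_sum Dt_ in
  let nu := fun l => inv_op (k l) \o Ad J (k l) in
  [/\ forall l, is_twist (nu l),
      multitwisted_zero_order A J nu,
      multitwisted_first_order A J Dt_ nu,
      regular J nu
    & (forall e, is_sign e -> epsilon_condition J D_ e ->
         multitwisted_epsilon_condition J Dt_ nu e)] /\
  ((forall l, symmetric_op (D_ l)) -> compact_resolvent Dt ->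
     multitwisted_real_structure A Dt J Dt_ nu /\
     forall g, real_even_spectral_triple A Dt J g ->
       even_multitwisted_real_structure A Dt J g Dt_ nu).
Proof.
move=> Dt_ Dt nu; have [[hA _ _ _] Jai [e es JJ] J0] := hD.
have kA l : A (k l) by case: (hk l).
have kpos l : positive_op (k l) by case: (hk l).
have kb l : bounded_op (k l) by case: (kpos l).
have ki l : bounded_inverse (k l) by case: (hk l).
have nu_twist l : is_twist (nu l).
  exact: (twist_is_twist Jai es JJ (kb l) (ki l)).
have nu_zero : multitwisted_zero_order A J nu.
  by move=> l a b; exact: (twist_zero_order Jai es JJ J0 (kA l) (ki l)).
split; first split=> //.
- move=> l a.
  exact: (rescaled_first_order Jai es JJ J0 (kA l) (kb l) (ki l) (hfirst l)).
- by move=> l; exact: (twist_regular Jai es JJ (kb l) (ki l)).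
- move=> s _ Ds l.
  exact: (rescaled_epsilon Jai es JJ J0 (kA l) (kb l) (ki l) (Ds l)).
move=> Dsym Dtres.
have Dtlin : linear_op Dt.
  apply: op_sum_linear => l; apply: (rescaled_linear Jai es JJ (kb l)).
  by case: hdec => /(_ l)[[]].
have Dtsym : symmetric_op Dt.
  apply: op_sum_symmetric => l.
  exact: (rescaled_symmetric Jai es JJ (kpos l)).
have Dtsa : selfadjoint_op Dt.
  exact: symmetric_compact_resolvent_selfadjoint.
have mult : multitwisted_real_structure A Dt J Dt_ nu.
  split=> //.
    split=> //; last by exists e.
    split=> // a Aa.
    have /choice[c Dc] : forall l, exists c, bounded_commutator (Dt_ l) a c.
      move=> l; have [c Dc _] := hfirst l a Aa.
      exists (Ad J (k l) \o c \o Ad J (k l)).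
      exact: (rescaled_commutator Jai es JJ J0 (kA l) (kb l)).
    exists (fun x => \sum_l c l x); apply: op_sum_commutator => //.
    by have [/(_ a Aa)[]] := hA.
  split=> // l; split=> [|x]; last exact.
  have [D0 Dlin] : linear_op (Dt_ l).
    apply: (rescaled_linear Jai es JJ (kb l)).
    by case: hdec => /(_ l)[[]].
  (* The domain of [Dt_ l] contains that of [Dt], which is dense. *)
  split=> // O O0 Oo.
  have [_ _ /(_ O O0 Oo)[x [Ox dx]]] := proj1 Dtsa.
  by exists x; split=> //; exact: dx.
split=> // g hg; split=> // l; have [_ [[gb _] _ gA [s ss gJ]]] := hg.
have gnu := twist_grading Jai es JJ (kb l) (ki l) ss gb (gA _ (kA l)) gJ.
by apply/funext => x; have /= gx y := congr1 (@^~ y) gnu; rewrite /= !gx.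
Qed.
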